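(* Let $\{\mu_i(x)\}_{i=0}^n$ be a blending basis and let $\bm A=[\mu_i(x_j)]_{j=0,i=0}^{m,n}\in\mathbb{R}^{(m+1)\times(n+1)}$ ($m\ge n$) be the corresponding collocation matrix on the real increasing sequence $\{x_j\}_{j=0}^m$. Put $\bar{\bm A}=\bm A^T\bm A$ and let $v$ be the largest eigenvalue of $\bar{\bm A}$. For a fixed number of iterations $k\ge 1$, suppose the step sizes $\{\omega_\ell\}_{\ell=0}^{k-1}$ of the ALSPIA method are $$\omega_\ell=\frac{1-\cos\left(\frac{2k+1}{2(k+1)}\pi\right)}{v\left(\cos\left(\frac{2\ell+1}{2(k+1)}\pi\right)-\cos\left(\frac{2k+1}{2(k+1)}\pi\right)\right)},\qquad \ell=0,1,\dots,k-1.$$ Then the limit, as $k\to\infty$, of the sequence of curves $\{\mathcal{C}^{(k)}(x)\}_{k=0}^\infty$ generated by the ALSPIA method is a least-squares curve of the initial data $\{\bm q_j\}_{j=0}^m$, even though $\bm A$ is rank deficient. In such a case, for every $k\ge1$, $$\rho\left(\widetilde P_{k+1}(\bar{\bm A})\right)\le\frac{v\pi}{2(k+1)^2},\qquad\text{where}\quad \widetilde P_{k+1}(\bar{\bm A})=\bar{\bm A}\prod_{\ell=0}^{k-1}\left(\bm I_{n+1}-\omega_\ell\bar{\bm A}\right).$$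
   Context: A blending basis $\{\mu_i\}_{i=0}^n$ is a family of nonnegative real functions on $[x_0,x_m]$ with $\sum_{i=0}^n\mu_i(x)=1$ for all $x$. The data are points $\bm q_0,\dots,\bm q_m$ in $\mathbb{R}^2$ or $\mathbb{R}^3$ with $m\ge n$, where $\bm q_j$ is associated with the parameter $x_j$ and $x_0<x_1<\dots<x_m$. Write $\bm q=[\bm q_0\ \cdots\ \bm q_m]^T$ (one point per row). ALSPIA method (curve fitting): start from arbitrary initial control points $\bm p^{(0)}=[\bm p^{(0)}_0\ \cdots\ \bm p^{(0)}_n]^T$ (one point per row, in the same space as the data) and, given step sizes $\omega_0,\omega_1,\dots$, iterate $$\bm p^{(\ell+1)}=\bm p^{(\ell)}+\omega_\ell\,\bm A^T\left(\bm q-\bm A\bm p^{(\ell)}\right),\qquad \ell=0,1,\dots.$$ The step sizes $\omega_\ell$ depend on the prescribed total number of iterations $k$. For each $k\ge1$, $\bm p^{(k)}$ denotes the control points obtained after $k$ iterations from $\bm p^{(0)}$ with the $k$ step sizes prescribed for that $k$, and $\mathcal{C}^{(k)}(x)=\sum_{i=0}^n\mu_i(x)\bm p^{(k)}_i$, $x\in[x_0,x_m]$; $\mathcal{C}^{(0)}$ is the initial curve, with control points $\bm p^{(0)}$. Limits of curves are taken pointwise in $x\in[x_0,x_m]$. A least-squares curve of the data is a curve $\sum_{i=0}^n\mu_i(x)\bm p^*_i$ whose control points $\bm p^*=[\bm p^*_0\ \cdots\ \bm p^*_n]^T$ form a least-squares solution of $\bm A\bm p=\bm q$, i.e. $\bm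 A^T\bm A\bm p^*=\bm A^T\bm q$. $\rho(\cdot)$ denotes the spectral radius and $\bm I_{n+1}$ the identity matrix of size $n+1$. Rank deficient means $\operatorname{rank}\bm A<n+1$. *)

(* Defs.v *)
From HB Require Import structures.
From mathcomp Require Import all_boot all_order all_algebra.
From mathcomp Require Import complex.
From mathcomp Require Import all_classical all_reals all_analysis.
Set Implicit Arguments.
Unset Strict Implicit.
Unset Printing Implicit Defensive.
Import Order.TTheory GRing.Theory Num.Theory.
Import numFieldNormedType.Exports.
Local Open Scope classical_set_scope.
Local Open Scope ring_scope.

Definition blending_basis (R : realType) (n : nat) (a b : R)
    (mu : 'I_n.+1 -> R -> R) : Prop :=
  forall t, a <= t <= b ->
    (forall i, 0 <= mu i t) /\ \sum_(i < n.+1) mu i t = 1.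

Definition collocation_mx (R : realType) (m n : nat)
    (mu : 'I_n.+1 -> R -> R) (x : 'I_m.+1 -> R) : 'M[R]_(m.+1, n.+1) :=
  \matrix_(j < m.+1, i < n.+1) mu i (x j).

Definition is_largest_eigenvalue (R : realType) (n : nat) (M : 'M[R]_n)
    (v : R) : Prop :=
  eigenvalue M v /\ forall a : R, eigenvalue M a -> a <= v.

(* The eigenvalues are the complex ones, so the matrix is first mapped into
   R[i]. Their set is finite, and nonempty when 0 < n, so that the supremum is
   a maximum. *)
Definition spectral_radius (R : realType) (n : nat) (M : 'M[R]_n) : R :=
  sup [set complex.Re `|z| | z in
        [set z : R[i] | eigenvalue (map_mx (real_complex R) M) z]].

(* The zeros of the Chebyshev polynomial of degree k.+1, for l <= k. *)
Definition cheb_zero (R : realType) (k l : nat) : R :=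
  cos ((2 * l + 1)%:R / (2 * (k + 1))%:R * pi).

Definition alspia_step (R : realType) (v : R) (k l : nat) : R :=
  (1 - cheb_zero R k k) / (v * (cheb_zero R k l - cheb_zero R k k)).

Fixpoint alspia (R : realType) (m n d : nat) (A : 'M[R]_(m.+1, n.+1))
    (q : 'M[R]_(m.+1, d)) (w : nat -> R) (p0 : 'M[R]_(n.+1, d)) (l : nat) :
    'M[R]_(n.+1, d) :=
  if l is l'.+1 then
    let p := alspia A q w p0 l' in p + w l' *: (A^T *m (q - A *m p))
  else p0.

(* Control points and data points are the rows of the matrices. *)
Definition curve (R : realType) (n d : nat) (mu : 'I_n.+1 -> R -> R)
    (p : 'M[R]_(n.+1, d)) (t : R) : 'rV[R]_d :=
  \sum_(i < n.+1) mu i t *: row i p.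

(* The step sizes are those prescribed for k iterations in total, so that the
   iterations for different k do not share intermediate control points. *)
Definition alspia_curve (R : realType) (m n d : nat) (mu : 'I_n.+1 -> R -> R)
    (A : 'M[R]_(m.+1, n.+1)) (q : 'M[R]_(m.+1, d)) (v : R)
    (p0 : 'M[R]_(n.+1, d)) (k : nat) : R -> 'rV[R]_d :=
  curve mu (alspia A q (alspia_step v k) p0 k).

Definition least_squares_solution (R : realType) (m n d : nat)
    (A : 'M[R]_(m.+1, n.+1)) (q : 'M[R]_(m.+1, d)) (p : 'M[R]_(n.+1, d)) :
    Prop :=
  A^T *m A *m p = A^T *m q.

Definition alspia_poly_mx (R : realType) (n : nat) (M : 'M[R]_n.+1) (v : R)
    (k : nat) : 'M[R]_n.+1 :=
  M *m \prod_(l < k) (1%:M - alspia_step v k l *: M).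

(* Main.v *)
Require Import Defs.
From mathcomp Require Import all_boot all_order all_algebra.
From mathcomp Require Import complex ring lra zify.
From mathcomp Require Import all_classical all_reals all_analysis.
Set Implicit Arguments.
Unset Strict Implicit.
Unset Printing Implicit Defensive.
Import Order.TTheory GRing.Theory Num.Theory.
Import numFieldNormedType.Exports.
Local Open Scope classical_set_scope.
Local Open Scope ring_scope.

(** The step sizes are the reciprocals of the nodes obtained by moving the
zeros c_0 > ... > c_k of the Chebyshev polynomial T_(k+1) affinely, in such a
way that c_k goes to 0 and 1 goes to v.  Hence
P_k = X (1 - w_0 X) ... (1 - w_(k-1) X) is T_(k+1) after an affine change of
variable, normalised by P_k'(0) = 1: if a = v (y - c_k) / (1 - c_k), then
P_k(a) = v / (1 - c_k) * T_(k+1)(y) / T_(k+1)'(c_k) ([alspia_poly_cheb]).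
For 0 <= a <= v the point y lies in [-1, 1], where |T_(k+1)| <= 1, and
differentiating T_(k+1)(cos t) = cos ((k+1) t) gives
|T_(k+1)'(c_k)| sin (pi / (2 (k+1))) = k+1.  With sin s <= s and c_k <= 0 this
yields |P_k(a)| <= v pi / (2 (k+1)^2) on [0, v] ([alspia_poly_bound]).

The Gram matrix M = A^T A is real symmetric with spectrum in [0, v], so it is
diagonalisable with real eigenvalues.  The eigenvalues of P_k(M) are the
P_k(r) for the eigenvalues r of M, which is the bound on the spectral radius,
and every entry of P_k(M) is a combination of the P_k(r) with coefficients
independent of k, so P_k(M) tends to 0
([symmetric_functional_calculus]).

For a least-squares solution ps, the error after k iterations is
(1 - w_0 M) ... (1 - w_(k-1) M) (p0 - ps).  These products do not tend to 0
when M is singular, since they fix its kernel.  But ps may be chosen so that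
p0 - ps = M U lies in the range of M, because A and M^2 have the same row space
([gram_sqr_rowspace]); the error is then P_k(M) U and tends to 0. *)

(** * Chebyshev polynomials *)

Fixpoint cheb (R : nzRingType) (n : nat) : {poly R} :=
  if n is n1.+1 then
    if n1 is n2.+1 then 2 *: (cheb R n1 * 'X) - cheb R n2 else 'X
  else 1.

Lemma chebSS (R : nzRingType) n :
  cheb R n.+2 = 2 *: (cheb R n.+1 * 'X) - cheb R n.
Proof. by []. Qed.

Lemma size_cheb (R : numDomainType) n : size (cheb R n) = n.+1.
Proof.
elim/ltn_ind: n => -[|[|n]] IH; [exact: size_poly1|exact: size_polyX|].
have IH1 := IH n.+1 (ltnSn _); have IH0 := IH n (ltnW (ltnSn _)).
have s : size (2 *: (cheb R n.+1 * 'X)) = n.+3.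
  rewrite size_scale ?pnatr_eq0// size_mulX ?IH1//.
  by rewrite -size_poly_gt0 IH1.
by rewrite chebSS size_polyDl s // size_polyN IH0.
Qed.

Lemma cheb_cos (R : realType) n (a : R) :
  (cheb R n).[cos a] = cos (n%:R * a).
Proof.
elim/ltn_ind: n => -[|[|n]] IH.
- by rewrite mul0r cos0 hornerE.
- by rewrite mul1r hornerE.
rewrite chebSS hornerD hornerN hornerZ hornerMX (IH n.+1)// (IH n)//.
have -> : n.+2%:R * a = n.+1%:R * a + a by rewrite -[in LHS]natr1 mulrDl mul1r.
have -> : n%:R * a = n.+1%:R * a - a by rewrite -[in RHS]natr1 mulrDl mul1r addrK.
by rewrite cosB cosD; ring.
Qed.

(** This is the derivative of [cheb_cos] with respect to the angle.  The
induction on the recurrence proves it formally, and keeping the factor sin a on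
the left avoids the Chebyshev polynomials of the second kind. *)
Lemma deriv_cheb_cos (R : realType) n (a : R) :
  (cheb R n)^`().[cos a] * sin a = n%:R * sin (n%:R * a).
Proof.
elim/ltn_ind: n => -[|[|n]] IH.
- by rewrite derivC horner0 !mul0r.
- by rewrite derivX hornerE !mul1r.
rewrite chebSS derivB derivZ derivM derivX mulr1.
rewrite hornerD hornerN hornerZ hornerD hornerMX.
transitivity (2 * cos a * ((cheb R n.+1)^`().[cos a] * sin a)
  + 2 * (cheb R n.+1).[cos a] * sin a - (cheb R n)^`().[cos a] * sin a).
  by ring.
rewrite (IH n)// (IH n.+1)// cheb_cos.
have -> : n.+2%:R * a = n.+1%:R * a + a by rewrite -[in LHS]natr1 mulrDl mul1r.
have -> : n%:R * a = n.+1%:R * a - a by rewrite -[in RHS]natr1 mulrDl mul1r addrK.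
rewrite sinB sinD; move: (sin (n.+1%:R * a)) (cos (n.+1%:R * a)) => S C.
rewrite -[n.+2]addn2 -[n.+1]addn1 !natrD.
by ring.
Qed.

Definition cheb_angle (R : realType) (k l : nat) : R :=
  (2 * l + 1)%:R / (2 * (k + 1))%:R * pi.

Lemma cheb_zeroE (R : realType) k l : cheb_zero R k l = cos (cheb_angle R k l).
Proof. by []. Qed.

Lemma cheb_angle_itv (R : realType) k l :
  (l <= k)%N -> cheb_angle R k l \in `[0, pi].
Proof.
move=> lk; rewrite in_itv /= /cheb_angle; apply/andP; split.
  by rewrite mulr_ge0 ?pi_ge0// divr_ge0.
rewrite ler_piMl ?pi_ge0// ler_pdivrMr ?mul1r ?ltr0n ?muln_gt0 ?addn1//.
rewrite ler_nat; lia.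
Qed.

Lemma cheb_angle_inj (R : realType) k l l' :
  cheb_angle R k l = cheb_angle R k l' -> l = l'.
Proof.
have pi0 : pi != 0 :> R by rewrite gt_eqF ?pi_gt0.
have k0 : (2 * (k + 1))%:R^-1 != 0 :> R.
  by rewrite invr_eq0 pnatr_eq0 muln_eq0 addn1.
move=> /(mulIf pi0) /(mulIf k0) /eqP.
by rewrite eqr_nat eqn_add2r eqn_mul2l => /eqP.
Qed.

Lemma mul_cheb_angle (R : realType) k l :
  k.+1%:R * cheb_angle R k l = l%:R * pi + pi / 2.
Proof.
rewrite /cheb_angle !natrM natrD natrM addn1; field.
by rewrite ?pnatr_eq0 -?natr1.
Qed.

Lemma cos_mul_cheb_angle (R : realType) k l :
  cos (k.+1%:R * cheb_angle R k l) = 0.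
Proof.
rewrite mul_cheb_angle cosDpihalf.
suff -> : sin (l%:R * pi) = 0 :> R by rewrite oppr0.
elim: l => [|l IH]; first by rewrite mul0r sin0.
by rewrite -natr1 mulrDl mul1r sinDpi IH oppr0.
Qed.

Lemma cheb_zero_root (R : realType) k l : root (cheb R k.+1) (cheb_zero R k l).
Proof. by rewrite rootE cheb_zeroE cheb_cos cos_mul_cheb_angle. Qed.

Lemma cheb_zero_inj (R : realType) k l l' : (l <= k)%N -> (l' <= k)%N ->
  cheb_zero R k l = cheb_zero R k l' -> l = l'.
Proof.
move=> lk l'k /(cos_inj (cheb_angle_itv R lk) (cheb_angle_itv R l'k)).
exact: cheb_angle_inj.
Qed.

Lemma cheb_last_angle (R : realType) k :
  cheb_angle R k k = pi - pi / (2 * k.+1%:R).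
Proof.
rewrite /cheb_angle !natrM natrD natrM natrD -natr1; field.
by rewrite nat1r pnatr_eq0.
Qed.

Lemma cheb_factor (R : realType) k :
  cheb R k.+1 = lead_coef (cheb R k.+1) *:
    \prod_(l < k.+1) ('X - (cheb_zero R k l)%:P).
Proof.
pose s := [seq cheb_zero R k l | l <- iota 0 k.+1].
have -> : \prod_(l < k.+1) ('X - (cheb_zero R k l)%:P)
          = \prod_(z <- s) ('X - z%:P).
  by rewrite /s big_map -[iota 0 _]/(index_iota 0 k.+1) big_mkord.
apply: all_roots_prod_XsubC.
- by rewrite size_cheb size_map size_iota.
- by apply/allP => _ /mapP[l _ ->]; exact: cheb_zero_root.
rewrite uniq_rootsE map_inj_in_uniq ?iota_uniq// => l l'.
by rewrite !mem_iota /= !add0n !ltnS; exact: cheb_zero_inj.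
Qed.

(** * The scalar bound *)

Lemma sin_le_id (R : realType) (x : R) : 0 <= x -> sin x <= x.
Proof.
move=> x0; have [c _] : exists2 c, c \in `[0, x] &
    sin x - sin 0 = cos c * (x - 0).
  apply: MVT_segment => //.
  by apply: continuous_subspaceT => y; exact: continuous_sin.
by rewrite sin0 !subr0 => ->; rewrite ler_piMl// cos_le1.
Qed.

(** Its image at M is [alspia_poly_mx M v k], see [alspia_poly_mxE]. *)
Definition alspia_poly (R : realType) (v : R) (k : nat) : {poly R} :=
  'X * \prod_(l < k) (1 - alspia_step v k l *: 'X).

(** The last zero is the cosine of pi minus an angle at most pi / 2; the bound
below only needs that the denominators 1 - c_k are at least 1. *)
Lemma cheb_last_le0 (R : realType) k : cheb_zero R k k <= 0.
Proof.
rewrite cheb_zeroE cheb_last_angle addrC cosDpi oppr_le0 cosN.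
apply: cos_ge0_pihalf; have p0 := pi_ge0 R.
apply/andP; split.
  by rewrite (@le_trans _ _ 0)// ?oppr_le0 divr_ge0// mulr_ge0.
by rewrite ler_pM2l ?pi_gt0// lef_pV2 ?posrE// ?mulr_gt0// ler_peMr// ler1n.
Qed.

(** At a zero of T_(k+1) the cosine of (k+1) a vanishes, so its sine is 1 or -1
in [deriv_cheb_cos]. *)
Lemma deriv_cheb_last (R : realType) k :
  `|(cheb R k.+1)^`().[cheb_zero R k k]| * sin (pi / (2 * k.+1%:R)) = k.+1%:R.
Proof.
have /(congr1 Num.norm) := deriv_cheb_cos k.+1 (cheb_angle R k k).
have /eqP := cos_mul_cheb_angle R k k; rewrite -norm_sin_eq1 => /eqP sn.
have -> : sin (cheb_angle R k k) = sin (pi / (2 * k.+1%:R)).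
  by rewrite cheb_last_angle addrC sinDpi sinN opprK.
rewrite !normrM sn mulr1 normr_nat cheb_zeroE => E.
rewrite -[RHS]E; congr (_ * _).
rewrite ger0_norm // sin_ge0_pi // divr_ge0 ?mulr_ge0 ?pi_ge0//=.
rewrite ler_piMr ?pi_ge0// invf_le1 ?mulr_gt0// -natrM ler1n.
by rewrite muln_gt0.
Qed.

(** Both sides are products over the zeros c_l: the factor 1 - w_l X takes the
value (y - c_l) / (c_k - c_l) at the image of y, and T_(k+1)'(c_k) is the
leading coefficient times the product of the c_k - c_l for l < k. *)
Lemma alspia_poly_cheb (R : realType) (v : R) k (y : R) :
  let ck := cheb_zero R k k in v != 0 -> ck != 1 ->
  (alspia_poly v k).[v * (y - ck) / (1 - ck)] * (cheb R k.+1)^`().[ck]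
  = v / (1 - ck) * (cheb R k.+1).[y].
Proof.
move=> ck v0 c1; rewrite /alspia_poly hornerM hornerX horner_prod.
rewrite [in RHS]cheb_factor [in LHS]cheb_factor big_ord_recr /= -/ck.
rewrite derivZ derivM derivXsubC mulr1 !hornerZ hornerD !hornerM !hornerXsubC.
rewrite subrr mulr0 add0r.
rewrite !horner_prod.
have -> : \prod_(l < k) ('X - (cheb_zero R k l)%:P).[y] =
   \prod_(l < k) (1 - alspia_step v k l *: 'X).[v * (y - ck) / (1 - ck)] *
   \prod_(l < k) ('X - (cheb_zero R k l)%:P).[ck].
  rewrite -big_split /=; apply: eq_bigr => l _.
  rewrite !hornerXsubC hornerD hornerN hornerZ hornerX -polyC1 hornerC.
  rewrite /alspia_step -/ck.
  have clk : cheb_zero R k l - ck != 0.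
    rewrite subr_eq0; apply/eqP.
    move=> /(cheb_zero_inj (ltnW (ltn_ord l)) (leqnn k)).
    by move=> e; have := ltn_ord l; rewrite e ltnn.
  by field; rewrite v0 clk subr_eq0 eq_sym c1.
by ring.
Qed.

(** For v = 0 the only argument is 0, where the polynomial vanishes; otherwise
this is [alspia_poly_cheb] with |T_(k+1)| <= 1 and [deriv_cheb_last]. *)
Lemma alspia_poly_bound (R : realType) (v : R) k (a : R) : 0 <= a <= v ->
  `|(alspia_poly v k).[a]| <= v * pi / (2 * (k%:R + 1) ^+ 2).
Proof.
move=> /andP[a0 av]; have := le_trans a0 av; rewrite le_eqVlt.
have [v0 _|v0 /= vpos] := eqVneq 0 v.
  have -> : a = 0 by apply/eqP; rewrite eq_le a0 [X in _ <= X]v0 av.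
  by rewrite /alspia_poly hornerM hornerX mul0r normr0 -v0 !mul0r.
have ck := cheb_last_le0 R k; have ck1 : 0 < 1 - cheb_zero R k k by lra.
pose y := cheb_zero R k k + a * (1 - cheb_zero R k k) / v.
(* y is the preimage of a under the affine map in [alspia_poly_cheb]. *)
have -> : a = v * (y - cheb_zero R k k) / (1 - cheb_zero R k k).
  by rewrite /y; field; rewrite !gt_eqF.
have yle : -1 <= y <= 1.
  have ckm : -1 <= cheb_zero R k k by exact: cos_geN1.
  have : 0 <= a / v <= 1 by rewrite divr_ge0 ?(ltW vpos)//= ler_pdivrMr// mul1r.
  rewrite /y mulrAC; move: (a / v) => z /andP[z0 z1]; nra.
have T1 : `|(cheb R k.+1).[y]| <= 1.
  by rewrite -(acosK yle) cheb_cos cos_max.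
have c1 : cheb_zero R k k != 1 by rewrite lt_eqF; lra.
have /(congr1 Num.norm) := alspia_poly_cheb y (lt0r_neq0 vpos) c1.
set p := (alspia_poly v k).[_]; have := deriv_cheb_last R k.
set D := (cheb R k.+1)^`().[cheb_zero R k k]; set s := sin _ => Ds.
rewrite -/D !normrM normfV (gtr0_norm vpos) (gtr0_norm ck1) => pD.
have N0 : 0 < k.+1%:R :> R by rewrite ltr0n.
have D0 : 0 < `|D|.
  rewrite normr_gt0; apply/eqP => D0.
  by move: N0; rewrite -Ds D0 normr0 mul0r ltxx.
have s0 : 0 <= s by rewrite -(pmulr_rge0 _ D0) Ds ltW.
have sx : s <= pi / (2 * k.+1%:R).
  by apply: sin_le_id; rewrite divr_ge0 ?pi_ge0// mulr_ge0.
have -> : v * pi / (2 * (k%:R + 1) ^+ 2) = v * (pi / (2 * k.+1%:R)) / k.+1%:R.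
  by rewrite natr1; field; rewrite nat1r pnatr_eq0.
rewrite ler_pdivlMr//.
have -> : `|p| * k.+1%:R = `|p| * `|D| * s by rewrite -mulrA Ds.
rewrite pD.
apply: ler_pM => //; first by rewrite mulr_ge0// divr_ge0 ?ltW.
rewrite -[leRHS]mulr1 ler_pM ?divr_ge0 ?(ltW vpos) ?(ltW ck1)//.
by rewrite ler_pdivrMr// ler_peMr ?(ltW vpos)//; lra.
Qed.

(** * Gram matrices and least squares *)

Lemma dot_self_ge0 (R : realDomainType) n (w : 'rV[R]_n) :
  0 <= (w *m w^T) 0 0.
Proof. by rewrite mxE sumr_ge0// => i _; rewrite mxE -expr2 sqr_ge0. Qed.

Lemma dot_self_eq0 (R : realDomainType) n (w : 'rV[R]_n) :
  w *m w^T = 0 -> w = 0.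
Proof.
move=> /matrixP/(_ 0 0); rewrite !mxE => /eqP; rewrite psumr_eq0; last first.
  by move=> i _; rewrite mxE -expr2 sqr_ge0.
move=> /allP w0; apply/rowP => i; rewrite mxE.
by have := w0 i (mem_index_enum i); rewrite mxE -expr2 sqrf_eq0 => /eqP.
Qed.

Lemma mulmx_tr_eq0 (R : realDomainType) m n (u : 'rV[R]_m) (B : 'M[R]_(m, n)) :
  u *m (B *m B^T) = 0 -> u *m B = 0.
Proof.
move=> uB; apply: dot_self_eq0.
by rewrite trmx_mul mulmxA -(mulmxA u) uB mul0mx.
Qed.

Lemma gram_eigenvalue_ge0 (R : realFieldType) m n (A : 'M[R]_(m, n)) (a : R) :
  eigenvalue (A^T *m A) a -> 0 <= a.
Proof.
move=> /eigenvalueP[u uA u0].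
have uu : 0 < (u *m u^T) 0 0.
  rewrite lt_def dot_self_ge0 andbT; apply: contra u0 => /eqP E.
  by apply/eqP/dot_self_eq0/matrixP => i j; rewrite !ord1 E mxE.
have : 0 <= (u *m A^T *m (u *m A^T)^T) 0 0 by exact: dot_self_ge0.
rewrite trmx_mul trmxK mulmxA -(mulmxA u) uA -scalemxAl mxE.
by rewrite pmulr_lge0.
Qed.

(** By [mulmx_tr_eq0], applied to A^T A and then to A^T, a vector killed by
(A^T A)^2 is killed by A^T; so (A^T A)^2 has at least the rank of A, while its
row space is contained in that of A. *)
Lemma gram_sqr_rowspace (R : realFieldType) m n (A : 'M[R]_(m, n)) :
  (A <= (A^T *m A) *m (A^T *m A))%MS.
Proof.
set S := A^T *m A; have ST : S^T = S by rewrite trmx_mul trmxK.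
have SA : (S *m S <= A)%MS by rewrite {2}/S mulmxA submxMl.
rewrite -(mxrank_leqif_sup SA) eqn_leq mxrankS //=.
have : (kermx (S *m S) <= kermx A^T)%MS.
  apply/rV_subP => u /sub_kermxP uSS; apply/sub_kermxP.
  apply: mulmx_tr_eq0; rewrite trmxK; apply: mulmx_tr_eq0.
  by rewrite ST.
move=> /mxrankS; rewrite !mxrank_ker mxrank_tr.
have := rank_leq_col A; have := rank_leq_row (S *m S).
lia.
Qed.

(** Among the least-squares solutions, this ps differs from p0 by an element of
the range of the Gram matrix, i.e. it keeps the component of p0 along the
kernel, which the iteration never changes.  With ps = p0 - M U the normal
equations become M^2 U = A^T (A p0 - q), solvable by [gram_sqr_rowspace]. *)
Lemma least_squares_in_range (R : realType) m n d (A : 'M[R]_(m.+1, n.+1))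
    (q : 'M[R]_(m.+1, d)) (p0 : 'M[R]_(n.+1, d)) :
  exists2 ps, least_squares_solution A q ps &
    exists U, p0 - ps = A^T *m A *m U.
Proof.
set S := A^T *m A; have ST : S^T = S by rewrite trmx_mul trmxK.
have /submxP[U EU] : ((A^T *m (A *m p0 - q))^T <= S *m S)%MS.
  rewrite trmx_mul trmxK; apply: submx_trans (gram_sqr_rowspace A).
  exact: submxMl.
exists (p0 - S *m U^T); last by exists U^T; rewrite opprB addrC subrK.
rewrite /least_squares_solution mulmxBr -/S mulmxA.
have := congr1 trmx EU; rewrite trmxK trmx_mul (trmx_mul S S) ST => <-.
by rewrite mulmxBr mulmxA opprB addrC subrK.
Qed.

(** The normal equations turn the correction A^T (q - A p) into -M (p - ps), so
each step multiplies the error by 1 - w_i M. *)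
Lemma alspia_error (R : realType) m n d (A : 'M[R]_(m.+1, n.+1))
    (q : 'M[R]_(m.+1, d)) w p0 ps l : least_squares_solution A q ps ->
  alspia A q w p0 l - ps =
    horner_mx (A^T *m A) (\prod_(i < l) (1 - w i *: 'X)) *m (p0 - ps).
Proof.
move=> lsq; elim: l => [|l IH].
  by rewrite big_ord0 rmorph1 mul1mx.
(* The new factor acts on the left, the big product grows on the right. *)
rewrite big_ord_recr /= [\prod_(i < l) _ * _]mulrC rmorphM /= -mulmxE.
rewrite -mulmxA -IH.
rewrite rmorphB rmorph1 /= horner_mxZ horner_mx_X mulmxBl mul1mx -scalemxAl.
rewrite addrAC; congr (_ + _); rewrite -scalerN; congr (_ *: _).
by rewrite !mulmxBr -lsq !mulmxA opprB.
Qed.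

Lemma alspia_poly_mxE (R : realType) n (M : 'M[R]_n.+1) v k :
  alspia_poly_mx M v k = horner_mx M (alspia_poly v k).
Proof.
rewrite /alspia_poly_mx /alspia_poly rmorphM /= horner_mx_X rmorph_prod.
congr (_ *m _); apply: eq_bigr => l _.
by rewrite /= rmorphB !rmorph1 /= horner_mxZ horner_mx_X.
Qed.

(** * Polynomials of a real symmetric matrix *)

Local Notation toC := (real_complex _).

(** The spectral theorem for Hermitian matrices applies over R[i].  Its basis
may be complex, but the eigenvalues are real, and a real number that is an
eigenvalue over R[i] is one over R. *)
Lemma symmetric_diagonalization (R : realType) n (S : 'M[R]_n.+1) : S^T = S ->
  exists2 P : 'M[R[i]]_n.+1, P \in unitmx &
  exists2 r : 'rV[R]_n.+1, forall l, eigenvalue S (r 0 l) &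
    map_mx toC S = invmx P *m diag_mx (map_mx toC r) *m P.
Proof.
move=> S_sym; set SC := map_mx toC S.
have SCherm : SC \is hermsymmx.
  apply: realsym_hermsym.
    apply/is_hermitianmxP.
    by rewrite expr0 scale1r map_mx_id // /SC map_trmx S_sym.
  by apply/mxOverP => i j; rewrite mxE complex_real.
have /orthomx_spectralP := hermitian_normalmx SCherm.
have Pu := spectral_unit SC.
have /mxOverP dr := hermitian_spectral_diag_real SCherm.
set P := spectralmx SC in Pu *; set D := spectral_diag SC in dr * => SE.
have DE : D = map_mx toC (map_mx (@complex.Re R) D).
  by apply/matrixP => i j; rewrite !mxE RRe_real.
exists P => //; exists (map_mx (@complex.Re R) D); last by rewrite -DE.
move=> l; rewrite -(eigenvalue_map toC); apply/eigenvalueP.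
exists (delta_mx 0 l *m P).
  rewrite -/SC SE !mulmxA mulmxK// -!rowE row_diag_mx -scalemxAl -rowE.
  by congr (_ *: _); rewrite mxE; apply/esym/RRe_real.
apply/eqP => /(congr1 (fun u => u *m invmx P)); rewrite mulmxK// mul0mx.
by move=> /matrixP/(_ 0 l); rewrite !mxE !eqxx => /eqP; rewrite oner_eq0.
Qed.

(** The r l are the eigenvalues in a diagonalisation of S.  The point of the
last clause is that the coefficients c are real and do not depend on the
polynomial: they are the real parts of products of entries of the change of
basis, so entrywise limits reduce to limits of values p.[r l]. *)
Lemma symmetric_functional_calculus (R : realType) n (S : 'M[R]_n.+1) :
  S^T = S -> exists r : 'I_n.+1 -> R,
  [/\ forall l, eigenvalue S (r l),
      forall p z, eigenvalue (map_mx toC (horner_mx S p)) z ->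
        exists l, z = toC p.[r l] &
      exists c : 'I_n.+1 -> 'I_n.+1 -> 'I_n.+1 -> R, forall p i j,
        horner_mx S p i j = \sum_l p.[r l] * c i j l].
Proof.
move=> /symmetric_diagonalization[P Pu [r rE SE]].
have pE p : map_mx toC (horner_mx S p) =
    invmx P *m diag_mx (\row_l toC p.[r 0 l]) *m P.
  rewrite map_horner_mx SE horner_mx_uconjC// horner_mx_diag.
  congr (_ *m diag_mx _ *m _); apply/rowP => l.
  by rewrite !mxE horner_map.
exists (r 0); split => //.
- move=> p z /eigenvalueP[u]; rewrite pE => uE u0.
  pose w := u *m invmx P.
  have wE : w *m diag_mx (\row_l toC p.[r 0 l]) = z *: w.
    by rewrite /w scalemxAl -uE !mulmxA mulmxK.
  have /rV0Pn[l wl] : w != 0.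
    apply: contra u0 => /eqP w0; apply/eqP.
    by rewrite -(mulmxKV Pu u) -/w w0 mul0mx.
  clearbody w; exists l; move: wE => /rowP/(_ l).
  rewrite mul_mx_diag !mxE mulrC.
  by move=> /(mulIf wl).
exists (fun i j l => complex.Re (invmx P i l * P l j)) => p i j.
have := congr1 (fun M : 'M[R[i]]_n.+1 => complex.Re (M i j)) (pE p).
rewrite [in LHS]mxE /= => ->; rewrite mul_mx_diag mxE raddf_sum.
apply: eq_bigr => l _ /=; rewrite !mxE.
rewrite mulrAC mulrC; case: (invmx P i l * P l j) => x y /=.
by rewrite mul0r subr0.
Qed.

(** The supremum defining the spectral radius is over a nonempty set because
R[i] is algebraically closed. *)
Lemma spectral_radius_le (R : realType) n (M : 'M[R]_n.+1) (b : R) :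
  (forall z, eigenvalue (map_mx (real_complex R) M) z ->
     complex.Re `|z| <= b) ->
  spectral_radius M <= b.
Proof.
move=> Mb; apply: ge_sup; last by move=> _ [z /= Mz <-]; exact: Mb.
have [z Mz] := @eigenvalue_closed _ _ (map_mx (real_complex R) M) (ltn0Sn n).
by exists (complex.Re `|z|), z.
Qed.

(** * Convergence *)

Lemma cvg_sum (R : realType) (I : finType) (f : I -> nat -> R) (a : I -> R) :
  (forall i, f i k @[k --> \oo] --> a i) ->
  \sum_i f i k @[k --> \oo] --> \sum_i a i.
Proof.
move=> fa; elim: (index_enum I) => [|i s IH].
  by under eq_fun do rewrite big_nil; rewrite big_nil; exact: cvg_cst.
by under eq_fun do rewrite big_cons; rewrite big_cons; exact: cvgD.
Qed.

Lemma cvg_lin_comb0 (R : realType) (I : finType) (f : I -> nat -> R)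
    (a : I -> R) : (forall i, f i k @[k --> \oo] --> 0) ->
  \sum_i f i k * a i @[k --> \oo] --> 0.
Proof.
move=> f0; have : \sum_i f i k * a i @[k --> \oo] --> \sum_i 0 * a i.
  by apply: cvg_sum => i; exact: cvgMr_tmp.
by rewrite big1 // => i _; rewrite mul0r.
Qed.

Lemma cvg_mx_coord (R : realType) m n (f : nat -> 'M[R]_(m, n))
    (M : 'M[R]_(m, n)) :
  (forall i j, f k i j @[k --> \oo] --> M i j) -> f k @[k --> \oo] --> M.
Proof.
move=> fM; apply/cvg_ballP => e e0.
have fe : \forall k \near \oo, forall i j, ball (M i j) e (f k i j).
  by do 2![apply: filter_forall => ?]; exact: (cvg_ball (fM _ _)).
by apply: filterS fe => k fk; split.
Qed.

Lemma cvg_alspia_poly (R : realType) (v a : R) : 0 <= a <= v ->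
  (alspia_poly v k).[a] @[k --> \oo] --> 0.
Proof.
move=> av; apply/norm_cvg0P.
pose b k : R := v * pi / 2 * (k.+1%:R^-1 * k.+1%:R^-1).
apply: (@squeeze_cvgr _ _ _ _ (cst 0) b).
- near=> k; rewrite normr_ge0 /=; have := alspia_poly_bound k av.
  suff -> : v * pi / (2 * (k%:R + 1) ^+ 2) = b k by [].
  by rewrite /b natr1 expr2 !invfM !mulrA.
- exact: cvg_cst.
have : b k @[k --> \oo] --> v * pi / 2 * (0 * 0).
  by apply: cvgMl_tmp; apply: cvgM; exact: cvg_harmonic.
by rewrite !mulr0.
Unshelve. all: by end_near. Qed.

(* No hypothesis on the rank of A: rank-deficient A are included. *)
Theorem theorem3p1 (R : realType) (m n d : nat)
  (hmn : (n <= m)%N) (hd : d = 2%N \/ d = 3%N)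
  (x : 'I_m.+1 -> R) (hx : forall i j : 'I_m.+1, (i < j)%N -> x i < x j)
  (mu : 'I_n.+1 -> R -> R) (hmu : blending_basis (x ord0) (x ord_max) mu)
  (q : 'M[R]_(m.+1, d)) (p0 : 'M[R]_(n.+1, d)) (v : R)
  (hv : is_largest_eigenvalue
          ((collocation_mx mu x)^T *m collocation_mx mu x) v) :
  let A := collocation_mx mu x in
  let Abar := A^T *m A in
  (exists2 ps : 'M[R]_(n.+1, d), least_squares_solution A q ps &
     forall t : R, x ord0 <= t <= x ord_max ->
       alspia_curve mu A q v p0 k t @[k --> \oo] --> curve mu ps t) /\
  (forall k : nat, (1 <= k)%N ->
     spectral_radius (alspia_poly_mx Abar v k)
       <= v * pi / (2 * (k%:R + 1) ^+ 2)).
Proof.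
move=> A Abar; have AbarT : Abar^T = Abar by rewrite trmx_mul trmxK.
have [r [r_eig r_spec [c r_coef]]] := symmetric_functional_calculus AbarT.
have r_itv l : 0 <= r l <= v.
  by rewrite (gram_eigenvalue_ge0 (r_eig l)) (proj2 hv _ (r_eig l)).
split=> [|k _]; last first.
  apply: spectral_radius_le => z; rewrite alspia_poly_mxE => /r_spec[l ->].
  rewrite normc_def /= expr0n addr0 sqrtr_sqr.
  exact: alspia_poly_bound.
have [ps ps_lsq [U psU]] := least_squares_in_range A q p0.
exists ps => // t _.
have pE k : alspia A q (alspia_step v k) p0 k =
    ps + horner_mx Abar (alspia_poly v k) *m U.
  apply/eqP; rewrite addrC -subr_eq; apply/eqP.
  rewrite (alspia_error _ _ _ ps_lsq) psU mulmxA /alspia_poly mulrC rmorphM /=.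
  by rewrite horner_mx_X.
apply: cvg_mx_coord => i j; rewrite /alspia_curve /curve.
under eq_fun do rewrite summxE.
rewrite summxE; apply: cvg_sum => l.
under eq_fun do rewrite !mxE pE mxE.
rewrite !mxE; apply: cvgMl_tmp.
suff : (horner_mx Abar (alspia_poly v k) *m U) l j @[k --> \oo] --> 0.
  by move=> /(cvgD (cvg_cst (ps l j))); rewrite addr0.
under eq_fun do rewrite mxE.
apply: cvg_lin_comb0 => b; under eq_fun do rewrite r_coef.
by apply: cvg_lin_comb0 => s; exact: cvg_alspia_poly.
Qed.
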